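(* Let $M$ be a basic $0,1$ matrix of size $8\times 8$. Then $\mathrm{rank}_{\mathbb{R}}(M) > 4$.
   Context: A $0,1$ matrix is basic if it has no all-zero rows or columns, no two identical rows and no two identical columns. $\mathrm{rank}_{\mathbb{R}}(M)$ is the usual rank over $\mathbb{R}$. *)

(* Defs.v *)
From mathcomp Require Import all_boot all_order all_algebra.
From mathcomp Require Import reals.

Set Implicit Arguments.
Unset Strict Implicit.
Unset Printing Implicit Defensive.

Import Order.TTheory GRing.Theory Num.Theory.
Local Open Scope ring_scope.

Definition zero_one_mx (R : nzRingType) (m n : nat) (M : 'M[R]_(m, n)) : Prop :=
  forall i j, M i j = 0 \/ M i j = 1.

Definition basic_mx (R : nzRingType) (m n : nat) (M : 'M[R]_(m, n)) : Prop :=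
  [/\ zero_one_mx M,
      forall i, row i M != 0,
      forall j, col j M != 0,
      injective (fun i => row i M)
    & injective (fun j => col j M)].

(* Main.v *)
Require Import Defs.
From mathcomp Require Import all_boot all_order all_algebra.
From mathcomp Require Import reals.

(** If M had rank at most 4, every row of M would be a combination of four rows
    of M.  Column j is then recorded by the bit word u_j of its entries in these
    four rows, row i by the word x_i of its four coefficients, and the entry
    M i j is the sum of the coefficients of x_i selected by u_j.  As no row or
    column of M is zero or repeated, the x_i are distinct and nonzero, and so
    are the u_j; after adjoining the zero word on both sides there are nine
    vertices u of the cube {0,1}^4 and nine vectors x in R^4 all of whose
    pairings are 0 or 1.

    Nine vertices are more than half of the cube, so in each of the four
    directions they contain both ends of an edge ([cube_edge]).  The pairings of
    x with these two ends differ by a coordinate of x, which is hence -1, 0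
    or 1 ([ternary_coefs]).

    The question is now finite: in the bipartite graph joining the 16 bit words
    to the 81 words over {-1,0,1} when their pairing is 0 or 1, there is no
    complete bipartite subgraph with nine vertices on each side.  A branch and
    bound search decides this ([no_biclique_ternary4]).  The bound is tight:
    zero and the eight words (a, 1 - a, b, c) pair to 0 or 1 with the eight
    vectors for 0, a, 1 - a, 1, b, 1 - b, c and 1 - c. *)

Set Implicit Arguments.
Unset Strict Implicit.
Unset Printing Implicit Defensive.

Import Order.TTheory GRing.Theory Num.Theory.
Local Open Scope ring_scope.

Fixpoint words (T : Type) (L : seq T) (n : nat) : seq (seq T) :=
  if n is n'.+1 then [seq a :: w | a <- L, w <- words L n'] else [:: [::]].

Lemma size_words (T : Type) (L : seq T) n : size (words L n) = (size L ^ n)%N.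
Proof. by elim: n => //= n IHn; rewrite size_allpairs IHn expnS. Qed.

Lemma mem_words (T : eqType) (L : seq T) n w :
  (w \in words L n) = (size w == n) && all (mem L) w.
Proof.
elim: n w => [|n IHn] [|a w] //=.
  by apply/negP => /allpairsP [] [b v] [].
apply/allpairsP/idP => [[[b v] /= [bL + [-> ->]]]|].
  by rewrite IHn eqSS bL /=.
rewrite eqSS => /and3P [sz_w aL wL].
by exists (a, w); split; rewrite // IHn sz_w.
Qed.

(** Deleting bit k sends more than 2 ^ n words to the 2 ^ n words of length n,
    so two of them collide, and colliding words differ in bit k only. *)
Lemma cube_edge n k (A : seq bitseq) :
    uniq A -> {in A, forall u, size u = n.+1} -> (k <= n)%N ->
    (2 ^ n < size A)%N ->
  exists s t, [/\ size s = k, s ++ true :: t \in A & s ++ false :: t \in A].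
Proof.
move=> uA szA le_kn gtA.
pose del (u : bitseq) := take k u ++ drop k.+1 u.
have split_u u : u \in A -> u = take k u ++ nth false u k :: drop k.+1 u.
  by move=> Au; rewrite -drop_nth ?cat_take_drop ?szA ?ltnS.
have [/hasP [u Au /hasP [v Av /andP [neq_uv /eqP eq_del]]]|noedge] :=
    boolP (has (fun u => has (fun v => (u != v) && (del u == del v)) A) A).
  have szt w : w \in A -> size (take k w) = k.
    by move=> Aw; rewrite size_takel // szA // ltnW.
  have /eqP := eq_del; rewrite eqseq_cat ?szt // => /andP [/eqP et /eqP ed].
  have Eu := split_u _ Au; have := split_u _ Av; rewrite -et -ed => Ev.
  exists (take k u), (drop k.+1 u); rewrite szt //.
  move: Au Av neq_uv; rewrite {1 2}Eu {1 2}Ev.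
  by case: (nth _ u k); case: (nth _ v k) => Au Av; rewrite ?eqxx.
suff: (size [seq del u | u <- A] <= size (words [:: true; false] n))%N.
  by rewrite size_map size_words leqNgt gtA.
apply: uniq_leq_size.
  rewrite map_inj_in_uniq // => u v Au Av eq_del.
  apply/eqP/negPn/negP => neq_uv; case/hasP: noedge; exists u => //.
  by apply/hasP; exists v; rewrite // neq_uv eq_del /=.
move=> _ /mapP [u Au ->]; rewrite mem_words; apply/andP; split.
  rewrite size_cat size_takel ?size_drop szA //; last exact: ltnW.
  by rewrite subSS subnKC.
by apply/allP => -[].
Qed.

(** The scalar product of a 0,1 vector with x.  A [foldr] rather than a big
    operator, so that it evaluates in [no_biclique_ternary4]. *)
Definition pairing (V : nmodType) (u : bitseq) (x : seq V) : V :=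
  foldr +%R 0 (mask u x).

Lemma pairingE (V : nmodType) u (x : seq V) :
  pairing u x = \sum_(a <- mask u x) a.
Proof. by rewrite unlock. Qed.

Lemma pairing_cat (V : nmodType) u v (x y : seq V) : size u = size x ->
  pairing (u ++ v) (x ++ y) = pairing u x + pairing v y.
Proof. by move=> sz; rewrite !pairingE mask_cat // big_cat. Qed.

Lemma pairing_map (V W : nmodType) (f : {additive V -> W}) u (x : seq V) :
  pairing u (map f x) = f (pairing u x).
Proof. by rewrite !pairingE -map_mask big_map raddf_sum. Qed.

Lemma pairing_false (V : nmodType) n (x : seq V) : pairing (nseq n false) x = 0.
Proof. by rewrite /pairing mask_false. Qed.

Lemma pairing_zero (V : nmodType) n u : pairing u (nseq n (0 : V)) = 0.
Proof.
rewrite pairingE big_seq big1 // => a /mem_mask.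
by rewrite mem_nseq => /andP [_ /eqP].
Qed.

Lemma sum_pairing (V : nmodType) (I : finType) (P : pred I) (F : I -> V) :
  \sum_(i | P i) F i = pairing (map P (enum I)) (map F (enum I)).
Proof.
by rewrite pairingE -map_mask -filter_mask big_map big_filter big_enum_cond.
Qed.

Definition zero_one (R : nzRingType) : pred R := [pred a | (a == 0) || (a == 1)].

Definition ternary : seq int := [:: -1; 0; 1].

(** The pairings of x with the two ends of an edge of direction k are both 0
    or 1, and differ by the k-th coordinate of x. *)
Lemma ternary_coefs (R : numDomainType) n (A : seq bitseq) (x : seq R) :
    uniq A -> {in A, forall u, size u = n.+1} -> size x = n.+1 ->
    (2 ^ n < size A)%N -> {in A, forall u, pairing u x \in @zero_one R} ->
  x \in [seq map intr y | y <- words ternary n.+1].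
Proof.
move=> uA szA szx gtA Ax.
have tern_a a : a \in x -> exists2 e, e \in ternary & a = e%:~R.
  move=> /(nthP 0) [k]; rewrite szx ltnS => le_kn <-.
  have [s [t [szs At Af]]] := cube_edge uA szA le_kn gtA.
  pose c := pairing s (take k x) + pairing t (drop k.+1 x).
  have sz : size s = size (take k x) by rewrite size_takel ?szx 1?ltnW.
  have pairing_edge b : pairing (s ++ b :: t) x = (if b then x`_k else 0) + c.
    rewrite -{1}(cat_take_drop k x) (drop_nth 0) ?szx // pairing_cat //.
    by rewrite addrCA; case: b; rewrite // add0r.
  have := Ax _ At; have := Ax _ Af; rewrite !pairing_edge add0r !inE.
  case/orP => /eqP ->; rewrite ?addr0; case/orP => /eqP Eb.
  - by exists 0.
  - by exists 1.
  - by exists (-1) => //; rewrite -[x`_k](addrK 1) Eb sub0r mulrN1z.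
  - by exists 0 => //; rewrite -[x`_k](addrK 1) Eb subrr.
elim: x n.+1 szx tern_a {uA szA gtA Ax} => [|a x IHx] [|m] //.
case=> szx tern; have [e eT ->] := tern a (mem_head a x).
have [b xb|y yw ->] := mapP (IHx m szx _).
  by apply: tern; rewrite inE xb orbT.
apply/mapP; exists (e :: y) => //.
by move: yw; rewrite !mem_words /= eqSS eT.
Qed.

(** Branch and bound search certifying that the relation r contains no product
    of k elements of A by l elements of B: B shrinks to the common neighbours of
    the elements of A chosen so far, and a branch closes when fewer than l of
    them remain.  The conditionals are not boolean connectives because a
    call-by-value evaluation would explore the closed branches as well. *)
Fixpoint no_biclique (T U : Type) (r : T -> U -> bool) (k l : nat)
    (A : seq T) (B : seq U) : bool :=
  if (size B < l)%N then true else
  match k, A with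
  | 0, _ => false
  | k'.+1, [::] => true
  | k'.+1, a :: A' =>
      if no_biclique r k' l A' (filter (r a) B) then no_biclique r k l A' B
      else false
  end.

(** Here P stands for the part of A whose common neighbours are counted. *)
Lemma no_bicliqueP (T U : Type) (r : T -> U -> bool) k l A B (P : pred T) :
    no_biclique r k l A B -> (k <= count P A)%N ->
  (count (fun b => all (fun a => P a ==> r a b) A) B < l)%N.
Proof.
elim: A k B => [|a A IHA] k B;
  case: (ltnP (size B) l) => [ltB _ _|geB];
  rewrite ?(leq_ltn_trans (count_size _ _) ltB) //= ltnNge geB /=.
  by case: k.
case: k => // k; case: ifP => // no_a no_A; case: (P a) => /= leA.
  apply: leq_ltn_trans (IHA _ _ no_a leA).
  by rewrite count_filter; apply/eq_leq/eq_count => b /=; rewrite andbC.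
by apply: IHA no_A _; rewrite add0n in leA.
Qed.

Lemma no_biclique_ternary4 :
  no_biclique (fun u y => zero_one (pairing u y)) 9 9
    (words [:: false; true] 4) (words ternary 4).
Proof. by vm_compute. Qed.

(** A set of more than half of the vertices of the cube forces X into the finite
    range of the search, whatever the ring. *)
Lemma two_families4 (R : numDomainType) (A : seq bitseq) (X : seq (seq R)) :
    uniq A -> uniq X ->
    {in A, forall u, size u = 4} -> {in X, forall x, size x = 4} ->
    {in A & X, forall u x, pairing u x \in @zero_one R} ->
  (8 < size A)%N -> (size X < 9)%N.
Proof.
move=> uA uX szA szX AX gtA.
have ternX x : x \in X -> x \in [seq map intr y | y <- words ternary 4].
  move=> Xx; apply: (ternary_coefs uA) => //; first exact: szX.
  by move=> u Au; apply: AX.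
have leA : (9 <= count (mem A) (words [:: false; true] 4))%N.
  apply: leq_trans gtA _; rewrite -size_filter; apply: uniq_leq_size => // u Au.
  by rewrite mem_filter mem_words szA //; apply/and3P; split=> //; apply/allP => -[].
apply: leq_ltn_trans (no_bicliqueP no_biclique_ternary4 leA).
rewrite -size_filter -(size_map (map (intr : int -> R))).
apply: uniq_leq_size => // x Xx; have /mapP [y yw Ex] := ternX x Xx.
apply/mapP; exists y => //; rewrite mem_filter yw andbT.
apply/allP => u _; apply/implyP => /= Au.
have := AX _ _ Au Xx; rewrite Ex pairing_map !inE.
by rewrite /zero_one /= -!(eqr_int R).
Qed.

(** A maximal free family of rows spans the row space; if it has fewer than r
    members, g is completed by repeating row 0. *)
Lemma row_factorization (F : fieldType) m n r (M : 'M[F]_(m.+1, n)) :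
    (\rank M <= r)%N ->
  exists (D : 'M_(m.+1, r)) (g : 'I_r -> 'I_m.+1), M = D *m rowsub g M.
Proof.
move=> le_r.
pose g (k : 'I_r) : 'I_m.+1 :=
  if insub (val k) is Some k' then maxrankfun M k' else ord0.
have /submxP [D E] : (M <= rowsub g M)%MS.
  rewrite -{1}(eq_maxrowsub M); apply/row_subP => k.
  have -> : row k (rowsub (maxrankfun M) M) = row (widen_ord le_r k) (rowsub g M).
    by rewrite !row_rowsub /g /= valK.
  exact: row_sub.
by exists D, g.
Qed.

Theorem lemma25 (R : realType) (M : 'M[R]_8) (hM : basic_mx M) :
  (4 < \rank M)%N.
Proof.
case: hM => M01 row_n0 col_n0 row_inj col_inj.
rewrite ltnNge; apply/negP => /row_factorization [D [g defM]].
pose u j := [seq M (g k) j == 1 | k <- enum 'I_4].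
pose x i := [seq D i k | k <- enum 'I_4].
(* u_j and x_i determine M i j, so that repeated or zero words would give
   repeated or zero columns and rows. *)
have ME i j : M i j = pairing (u j) (x i).
  rewrite -sum_pairing {1}defM mxE [RHS]big_mkcond; apply: eq_bigr => k _.
  rewrite mxE; case: eqP => [->|]; first exact: mulr1.
  by case: (M01 (g k) j) => -> //; rewrite mulr0.
have szu j : size (u j) = 4 by rewrite size_map size_enum_ord.
have szx i : size (x i) = 4 by rewrite size_map size_enum_ord.
pose A := nseq 4 false :: [seq u j | j <- enum 'I_8].
pose X := nseq 4 0 :: [seq x i | i <- enum 'I_8].
have uA : uniq A.
  rewrite /= map_inj_uniq ?enum_uniq ?andbT => [|j j' Eu]; last first.
    by apply: col_inj; apply/colP => i; rewrite !mxE !ME Eu.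
  apply/mapP => -[j _ Eu]; case/eqP: (col_n0 j).
  by apply/colP => i; rewrite !mxE ME -Eu (@pairing_false R 4).
have uX : uniq X.
  rewrite /= map_inj_uniq ?enum_uniq ?andbT => [|i i' Ex]; last first.
    by apply: row_inj; apply/rowP => j; rewrite !mxE !ME Ex.
  apply/mapP => -[i _ Ex]; case/eqP: (row_n0 i).
  by apply/rowP => j; rewrite !mxE ME -Ex (@pairing_zero R 4).
have szA : {in A, forall v, size v = 4}.
  by move=> v; rewrite inE => /orP [/eqP ->|/mapP [j _ ->]].
have szX : {in X, forall y, size y = 4}.
  by move=> y; rewrite inE => /orP [/eqP ->|/mapP [i _ ->]].
have AX : {in A & X, forall v y, pairing v y \in @zero_one R}.
  move=> v y; rewrite [v \in _]inE [y \in _]inE.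
  case/orP => [/eqP -> _|/mapP [j _ ->]].
    by rewrite (@pairing_false R 4) !inE eqxx.
  case/orP => [/eqP ->|/mapP [i _ ->]].
    by rewrite (@pairing_zero R 4) !inE eqxx.
  by rewrite -ME !inE; case: (M01 i j) => ->; rewrite eqxx ?orbT.
have size9 T (a : T) f : size (a :: [seq f i | i <- enum 'I_8]) = 9.
  by rewrite /= size_map size_enum_ord.
by have := two_families4 uA uX szA szX AX; rewrite !size9 => /(_ isT).
Qed.
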